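(* For any integer $n\geq 2$, there is a clopen tree section in $F(2^{\mathbb{Z}^n})$ that is both complete and co-complete.
   Context: $2^{\mathbb{Z}^n}=\{0,1\}^{\mathbb{Z}^n}$ carries the product topology (with $\{0,1\}$ discrete), and $\mathbb{Z}^n$ acts on it by the Bernoulli shift $(g\cdot x)(h)=x(g+h)$ for $g,h\in\mathbb{Z}^n$. The free part is $F(2^{\mathbb{Z}^n})=\{x\in 2^{\mathbb{Z}^n}: \forall g\in\mathbb{Z}^n\ (g\neq \overline{0}\Rightarrow g\cdot x\neq x)\}$, with the subspace topology. The orbit of $x$ is $[x]=\{g\cdot x: g\in\mathbb{Z}^n\}$. $e_1,\dots,e_n$ are the standard basis vectors of $\mathbb{Z}^n$. The Schreier graph of $F(2^{\mathbb{Z}^n})$ is the graph with vertex set $F(2^{\mathbb{Z}^n})$ in which $\{x,y\}$ is an edge iff $y=e_i\cdot x$ or $y=-e_i\cdot x$ for some $1\leq i\leq n$. A tree section in $F(2^{\mathbb{Z}^n})$ is a subgraph $T$ of the Schreier graph (with vertex set $V(T)$ and edge set $E(T)$) such that each connected component of $T$ is an infinite acyclic graph. $T$ is complete if $V(T)\cap[x]\neq\varnothing$ for every $x\in F(2^{\mathbb{Z}^n})$, and co-complete if $[x]\setminus V(T)\neq\varnothing$ for every $x\in F(2^{\mathbb{Z}^n})$. $T$ is clopen if $V(T)$ is a clopen subset of $F(2^{\mathbb{Z}^n})$ and, for each $1\leq i\leq n$, the set $\{x\in F(2^{\mathbb{Z}^n}): \{x,e_i\cdot x\}\in E(T)\}$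 is clopen in $F(2^{\mathbb{Z}^n})$. *)

(* Defs.v *)
From HB Require Import structures.
From mathcomp Require Import all_boot all_order all_algebra.
From mathcomp Require Import all_classical topology.

Set Implicit Arguments.
Unset Strict Implicit.
Unset Printing Implicit Defensive.
Import GRing.Theory.

Local Open Scope classical_set_scope.
Local Open Scope ring_scope.

(* A simple graph whose vertices are elements of the ambient type V; the edge
   {x, y} is represented by the symmetric, irreflexive relation adj. *)
Record graph (V : Type) := Graph {
  vertices : set V;
  adj : rel V;
  adj_sym : forall x y, adj x y = adj y x;
  adj_irr : forall x, adj x x = false;
  adj_vertices : forall x y, adj x y -> vertices x
}.

Section graph_theory.
Variable V : choiceType.
Implicit Types (G H : graph V) (x y : V).

Definition subgraph H G : Prop :=
  vertices H `<=` vertices G /\ (forall x y, adj H x y -> adj G x y).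

Section induced.
Variables (G : graph V) (A : set V).

Let ivertices : set V := vertices G `&` A.
Let iadj : rel V := fun x y => [&& x \in A, y \in A & adj G x y].

Let iadj_sym x y : iadj x y = iadj y x.
Proof. by rewrite /iadj adj_sym andbCA. Qed.

Let iadj_irr x : iadj x x = false.
Proof. by rewrite /iadj adj_irr !andbF. Qed.

Let iadj_vertices x y : iadj x y -> ivertices x.
Proof. by case/and3P => /set_mem Ax _ xy; split=> //; exact: adj_vertices xy. Qed.

Definition induced : graph V := Graph iadj_sym iadj_irr iadj_vertices.

End induced.

Definition reachable G x y : Prop :=
  exists2 p : seq V, path (adj G) x p & last x p = y.

(* The connected component of the vertex x of G. *)
Definition component G x : graph V := induced G [set y | reachable G x y].

Definition infinite_graph G : Prop := infinite_set (vertices G).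

Definition acyclic G : Prop :=
  forall c : seq V, (2 < size c)%N -> ~ ucycle (adj G) c.

End graph_theory.

(* 2^(Z^n) with the product topology (bool is canonically discrete). *)
Definition shift_space (n : nat) := {ptws 'rV[int]_n -> bool}.

HB.instance Definition _ n := Topological.on (shift_space n).

Definition shift n (g : 'rV[int]_n) (x : shift_space n) : shift_space n :=
  fun h => x (g + h).

Definition free_set n : set (shift_space n) :=
  [set x | forall g : 'rV[int]_n, g <> 0 -> shift g x <> x].

(* set_type carries the subspace topology. *)
Definition free_part (n : nat) := set_type (@free_set n).

HB.instance Definition _ n := Topological.on (free_part n).

Lemma free_set_shift n (g : 'rV[int]_n) (x : shift_space n) :
  free_set x -> free_set (shift g x).
Proof.
move=> Fx h h0 /(congr1 (shift (- g))) e; apply: (Fx h h0).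
apply/funext => k; move/(congr1 (fun y : shift_space n => y k)): e.
by rewrite /shift [h + _]addrCA !(addrA g) subrr !add0r.
Qed.

Definition free_shift n (g : 'rV[int]_n) (x : free_part n) : free_part n :=
  SigSub (mem_set (@free_set_shift n g _ (set_valP x))).

Definition orbit n (x : free_part n) : set (free_part n) :=
  range (fun g => free_shift g x).

Definition basis_vec n (i : 'I_n) : 'rV[int]_n := delta_mx 0 i.

Section schreier.
Variable n : nat.
Implicit Types x y : free_part n.

Let sadj : rel (free_part n) := fun x y =>
  `[< exists i : 'I_n, y = free_shift (basis_vec i) x \/
                       y = free_shift (- basis_vec i) x >].

Lemma free_shiftK (g : 'rV[int]_n) : cancel (free_shift g) (free_shift (- g)).
Proof.
move=> x; apply: val_inj; apply/funext => k.
by rewrite /= /shift addrA subrr add0r.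
Qed.

Lemma free_shift_neq (g : 'rV[int]_n) x : g <> 0 -> x <> free_shift g x.
Proof. by move=> g0 /(congr1 val) /esym; exact: (set_valP x). Qed.

Lemma basis_vec_neq0 (i : 'I_n) : basis_vec i <> 0.
Proof. by move=> /matrixP /(_ 0 i); rewrite !mxE !eqxx. Qed.

Let sadj_sym x y : sadj x y = sadj y x.
Proof.
have sub x' y' : sadj x' y' -> sadj y' x'.
  move=> /asboolP[i [->|->]]; apply/asboolP; exists i; [right|left].
    by rewrite free_shiftK.
  by rewrite -[X in free_shift X (free_shift _ _)]opprK free_shiftK.
by apply/idP/idP; exact: sub.
Qed.

Let sadj_irr x : sadj x x = false.
Proof.
apply/asboolP => -[i []]; apply: free_shift_neq; first exact: basis_vec_neq0.
by move=> /eqP; rewrite oppr_eq0 => /eqP; exact: basis_vec_neq0.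
Qed.

Let sadj_vertices x y : sadj x y -> [set: free_part n] x.
Proof. by []. Qed.

Definition schreier_graph : graph (free_part n) :=
  Graph sadj_sym sadj_irr sadj_vertices.

End schreier.

Section sections.
Variable n : nat.
Implicit Type T : graph (free_part n).

Definition tree_section T : Prop :=
  subgraph T (schreier_graph n) /\
  (forall x, vertices T x ->
     infinite_graph (component T x) /\ acyclic (component T x)).

Definition complete_section T : Prop :=
  forall x : free_part n, (vertices T `&` orbit x) !=set0.

Definition cocomplete_section T : Prop :=
  forall x : free_part n, (orbit x `\` vertices T) !=set0.

Definition clopen_section T : Prop :=
  clopen (vertices T) /\
  (forall i : 'I_n, clopen [set x | adj T x (free_shift (basis_vec i) x)]).

End sections.

(* Main.v *)
Require Import Defs.
From mathcomp Require Import all_boot all_order all_algebra.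
From mathcomp Require Import all_classical topology.

(** Write [g.x] for the shift action and fix two directions [i <> j] of [Z^n],
    with basis vectors [e_i] and [e_j].  If the tree section did not have to
    miss a point of every orbit, one could take all edges [{x, e_i.x}]: every
    component is then a bi-infinite line.  To miss points, remove a clopen set
    of cut points.  This breaks lines into pieces, some of which may be finite;
    they become infinite again because each piece ending at [x], just before
    the cut point [e_i.x], is continued by the edge from [x] to [e_j.x].  So
    every remaining [x] has a single successor, [e_i.x] or [e_j.x], and the
    section is the graph of this successor map.

    Both moves raise the coordinate sum of the position in the orbit by one.
    Hence the forward iterates of a vertex are pairwise distinct, so components
    are infinite ([component_infinite]); and a lowest vertex of a cycle would
    have two distinct successors, so components are acyclic
    ([acyclic_of_height]).

    The one requirement on the cut set is that [e_j.x] is not a cut point when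
    [e_i.x] is one, that is, with [d = e_j - e_i], that no cut point is mapped
    to a cut point by [d].  Successors are then never cut points, which makes the
    section complete, and
    co-completeness says that every orbit contains a cut point.  The first
    candidate is the set of occurrences of the pattern 01 along [d]: no two of
    them are adjacent.  An orbit without 01 is nonincreasing along [d] and, by
    freeness, somewhere not constant, so it contains 1100; the occurrences of
    1100 can be added without creating adjacent cut points ([cut_shiftF],
    [exists_cut]). *)

Set Implicit Arguments.
Unset Strict Implicit.
Unset Printing Implicit Defensive.
Import Order.TTheory GRing.Theory Num.Theory.

Local Open Scope classical_set_scope.
Local Open Scope ring_scope.

(** * Graphs in which vertices have at most one upper neighbour *)

Lemma seq_argmin (V : eqType) (h : V -> int) (s : seq V) :
  (0 < size s)%N -> exists2 m, m \in s & {in s, forall y, h m <= h y}.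
Proof.
elim: s => // a [|b s] IH _.
  by exists a => [|y]; rewrite inE // => /eqP ->.
have [//|m ms mmin] := IH.
have [ham|hma] := leP (h a) (h m).
  exists a => [|y]; first exact: mem_head.
  by rewrite inE => /predU1P[-> //|/mmin]; exact: le_trans.
exists m => [|y]; first by rewrite inE ms orbT.
by rewrite inE => /predU1P[->|/mmin //]; exact: ltW.
Qed.

(** On a cycle, both neighbours of a vertex of least height would be its image
    under [f], although they are distinct. *)
Lemma acyclic_of_height (V : choiceType) (G : graph V) (f : V -> V)
    (h : V -> int) :
  (forall x y, adj G x y -> h x <= h y -> y = f x) -> acyclic G.
Proof.
move=> up c c2 cyc.
have [m mc mmin] := seq_argmin h (ltnW (ltnW c2)).
have [k q rotc] := rot_to mc.
move: cyc; rewrite -(rot_ucycle k) rotc => /andP[].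
have hmin y : y \in m :: q -> h m <= h y by rewrite -rotc mem_rot; exact: mmin.
have : (2 < size (m :: q))%N by rewrite -rotc size_rot.
case: q {rotc} hmin => [|a q] //=; case/lastP: q => [|q b] //= hmin _.
rewrite rcons_path last_rcons => /andP[ma /andP[_ bm]] /and3P[_ + _].
have -> : a = f m.
  by apply: up ma (hmin _ _); rewrite !inE eqxx orbT.
have -> : b = f m.
  rewrite adj_sym in bm.
  by apply: up bm (hmin _ _); rewrite !inE mem_rcons mem_head !orbT.
by rewrite mem_rcons mem_head.
Qed.

(** * Clopen sets given by Boolean functions *)

Section clopen_bool.
Variable X : topologicalType.
Implicit Types P Q : pred X.

Lemma clopen_negb P : clopen [set x | P x] -> clopen [set x | ~~ P x].
Proof.
move=> /(clopenC set0); congr clopen.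
by apply/seteqP; split=> x /= /negP.
Qed.

Lemma clopen_andb P Q : clopen [set x | P x] -> clopen [set x | Q x] ->
  clopen [set x | P x && Q x].
Proof.
move=> cP cQ; have := clopenI cP cQ; congr clopen.
by apply/seteqP; split=> x /andP.
Qed.

Lemma clopen_orb P Q : clopen [set x | P x] -> clopen [set x | Q x] ->
  clopen [set x | P x || Q x].
Proof.
move=> cP cQ; have := clopenU cP cQ; congr clopen.
by apply/seteqP; split=> x /orP.
Qed.

Lemma clopen_const (b : bool) : clopen [set x : X | b].
Proof.
case: b; [have := @clopenT X|have := @clopen0 X]; congr clopen.
  by apply/seteqP; split.
by apply/seteqP; split.
Qed.

End clopen_bool.

(** * The free part and the height of a point in its orbit *)

Section free_part.
Variable n : nat.
Implicit Types (x y : free_part n) (g h : 'rV[int]_n) (i j : 'I_n).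

Lemma clopen_coord g : clopen [set x : free_part n | val x g].
Proof.
have cval : continuous (val : free_part n -> shift_space n).
  exact: initial_continuous.
have cproj : continuous (fun x : shift_space n => x g).
  exact: (@proj_continuous 'rV[int]_n (fun=> bool) g).
have cbool : clopen [set b : bool | b].
  by split; [exact: discrete_open|exact: discrete_closed].
exact: preimage_clopen (preimage_clopen cbool cproj) cval.
Qed.

Lemma free_shift0 x : free_shift 0 x = x.
Proof. by apply: val_inj; apply/funext => k; rewrite /= /shift add0r. Qed.

Lemma free_shiftD g h x : free_shift g (free_shift h x) = free_shift (g + h) x.
Proof.
by apply: val_inj; apply/funext => k; rewrite /= /shift addrA (addrC h).
Qed.

Lemma free_shift_inj x : injective (fun g => free_shift g x).
Proof.
move=> g h /= /(congr1 (free_shift (- g))).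
rewrite free_shiftK free_shiftD => xE; apply/esym/eqP; rewrite -subr_eq0 addrC.
by apply/eqP; apply: contrapT => /free_shift_neq/(_ xE).
Qed.

Definition coord_sum g : int := \sum_k g 0 k.

Lemma coord_sum0 : coord_sum 0 = 0.
Proof. by rewrite /coord_sum big1 // => k _; rewrite mxE. Qed.

Lemma coord_sumD g h : coord_sum (g + h) = coord_sum g + coord_sum h.
Proof. by rewrite -big_split; apply: eq_bigr => k _; rewrite mxE. Qed.

Lemma coord_sum_basis i : coord_sum (basis_vec i) = 1.
Proof.
rewrite /coord_sum (bigD1 i) //= big1 => [|k ki]; rewrite !mxE !eqxx ?addr0 //.
by rewrite (negPf ki).
Qed.

Lemma basis_vec_inj : injective (@basis_vec n).
Proof.
move=> i j /matrixP/(_ 0 j); rewrite !mxE !eqxx /=.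
by case: (j =P i) => [->|].
Qed.

(** By freeness a point [y] of the orbit of [x] is [g.x] for a unique [g], so
    this is the coordinate sum of that [g]. *)
Definition height x y : int := coord_sum (xget 0 [set g | y = free_shift g x]).

Lemma height_shift x g : height x (free_shift g x) = coord_sum g.
Proof.
rewrite /height (@xget_unique _ _ _ g) // => h /=.
by move=> /free_shift_inj.
Qed.

Lemma reachable_orbit (G : graph (free_part n)) x y :
  subgraph G (schreier_graph n) -> reachable G x y -> Defs.orbit x y.
Proof.
move=> [_ GS] [p px <-] {y}.
suff: forall z, Defs.orbit x z -> path (adj G) z p ->
    Defs.orbit x (last z p).
  by apply=> //; exists 0; rewrite // free_shift0.
elim: p {px} => //= y p IH z [g _ <-] /andP[/GS/asboolP zy]; apply: IH.
case: zy => k [->|->]; rewrite free_shiftD.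
  by exists (basis_vec k + g).
by exists (- basis_vec k + g).
Qed.

(** * Cut points *)

Section cut.
Variable d : 'rV[int]_n.

(** Along [d], the pattern 01 at the positions 0 and 1, or the pattern 1100 at
    the positions -1, 0, 1 and 2. *)
Definition cut x : bool :=
  (~~ val x 0 && val x d) ||
  [&& val x (- d), val x 0, ~~ val x d & ~~ val x (d + d)].

Lemma clopen_cut g : clopen [set x | cut (free_shift g x)].
Proof.
(* the shifted value of [x] at [h] is that of [x] at [g + h] *)
have c h : clopen [set x : free_part n | val (free_shift g x) h].
  exact: clopen_coord (g + h).
apply: clopen_orb.
  by apply: clopen_andb => //; exact: clopen_negb.
do 3![apply: clopen_andb => //]; exact: clopen_negb.
Qed.

(** Overlaying either pattern with either pattern moved by one always puts a 0
    and a 1 on the same position. *)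
Lemma cut_shiftF x : cut x -> cut (free_shift d x) = false.
Proof.
rewrite /cut /= /shift addr0 subrr.
by case: (val x 0) (val x d) (val x (d + d)) (val x (- d)) => [] [] [] [].
Qed.

Lemma exists_cut x : d <> 0 -> exists g, cut (free_shift g x).
Proof.
move=> d0; apply: contrapT => nocut.
have cutF g : cut (free_shift g x) = false.
  by apply/negP => cg; apply: nocut; exists g.
have decr g : val x (g + d) -> val x g.
  move=> xgd; move: (cutF g); rewrite /cut /= /shift addr0 xgd andbT.
  by case: (val x g).
have const g : val x (g + d) = val x g.
  apply/idP/idP => [/decr //|xg]; apply: contraT => xgd.
  move: (cutF g); rewrite /cut /= /shift addr0 (decr (g - d)) ?subrK // xg xgd.
  by rewrite addrA (contra (decr (g + d)) xgd).
apply: (free_shift_neq (x := x) d0); apply: val_inj.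
by apply/funext => k; rewrite /= /shift addrC const.
Qed.

End cut.

(** * The tree section *)

Section tree.
Variables i j : 'I_n.
Hypothesis ij : i <> j.

Let d : 'rV[int]_n := basis_vec j - basis_vec i.

Let d_neq0 : d <> 0.
Proof. by move=> /eqP; rewrite subr_eq0 => /eqP/basis_vec_inj/esym. Qed.

Definition direction x : 'I_n :=
  if cut d (free_shift (basis_vec i) x) then j else i.

Definition succ x : free_part n := free_shift (basis_vec (direction x)) x.

Lemma cut_succ x : cut d (succ x) = false.
Proof.
rewrite /succ /direction; case: ifP => // cx.
by rewrite -(cut_shiftF cx) free_shiftD subrK.
Qed.

Lemma iter_succ k x :
  exists2 g, iter k succ x = free_shift g x & coord_sum g = k%:Z.
Proof.
elim: k => [|k [g kE gk]]; first by exists 0; rewrite ?free_shift0 ?coord_sum0.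
exists (basis_vec (direction (iter k succ x)) + g).
  by rewrite -free_shiftD -kE.
by rewrite coord_sumD coord_sum_basis gk.
Qed.

Lemma iter_succ_inj x : injective (fun k => iter k succ x).
Proof.
move=> k l /=; have [g -> gk] := iter_succ k x; have [h -> hl] := iter_succ l x.
by move=> /free_shift_inj gh; move: gk; rewrite gh hl => -[].
Qed.

Let tadj : rel (free_part n) := fun x y =>
  [&& ~~ cut d x, ~~ cut d y & (y == succ x) || (x == succ y)].

Let tadj_sym x y : tadj x y = tadj y x.
Proof. by rewrite /tadj andbCA orbC. Qed.

Let tadj_irr x : tadj x x = false.
Proof.
rewrite /tadj orbb; apply/negP => /and3P[_ _ /eqP].
exact/free_shift_neq/basis_vec_neq0.
Qed.

Let tadj_vertices x y : tadj x y -> [set z | ~~ cut d z] x.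
Proof. by case/and3P. Qed.

Definition succ_graph : graph (free_part n) :=
  Graph tadj_sym tadj_irr tadj_vertices.

Lemma succ_graph_schreier : subgraph succ_graph (schreier_graph n).
Proof.
split=> // x y /and3P[_ _ /orP[]] /eqP E; apply/asboolP.
  by exists (direction x); left.
by exists (direction y); right; rewrite E free_shiftK.
Qed.

Lemma succ_graph_reachable k x :
  ~~ cut d x -> reachable succ_graph x (iter k succ x).
Proof.
elim: k x => [|k IH] x cx; first by exists nil.
have [|p pp pl] := IH (succ x); first by rewrite cut_succ.
exists (succ x :: p); last by rewrite /= pl -iterSr.
by rewrite /= pp /tadj cx cut_succ eqxx.
Qed.

Lemma component_infinite x :
  vertices succ_graph x -> infinite_graph (component succ_graph x).
Proof.
move=> cx /(finite_preimage (f := fun k => iter k succ x)).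
move=> /(_ (in2W (@iter_succ_inj x))); apply: sub_infinite_set infinite_nat.
move=> k _; split; last exact: succ_graph_reachable.
by case: k => //= k; rewrite cut_succ.
Qed.

Lemma component_acyclic x : acyclic (component succ_graph x).
Proof.
apply: (@acyclic_of_height _ _ succ (height x)) => y z.
move=> /and3P[_ /set_mem xz /and3P[_ _ /orP[/eqP //|/eqP ->]]].
have [g _ <-] := reachable_orbit succ_graph_schreier xz.
rewrite {1}/succ free_shiftD !height_shift coord_sumD coord_sum_basis.
by rewrite gerDr.
Qed.

Lemma succ_graph_tree_section : tree_section succ_graph.
Proof.
split; first exact: succ_graph_schreier.
by move=> x Tx; split; [exact: component_infinite|exact: component_acyclic].
Qed.

(** The reversed edge, from [e_k.x] back to [x], is impossible because a
    successor is higher than its predecessor. *)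
Lemma succ_graph_adjE k x :
  adj succ_graph x (free_shift (basis_vec k) x) =
  ~~ cut d x && (k == direction x).
Proof.
have backF : (x == succ (free_shift (basis_vec k) x)) = false.
  apply/eqP; rewrite /succ free_shiftD -{1}[x]free_shift0 => /free_shift_inj.
  by move=> /(congr1 coord_sum); rewrite coord_sum0 coord_sumD !coord_sum_basis.
rewrite /= /tadj backF orbF; congr (_ && _); apply/idP/idP.
  by move=> /andP[_ /eqP/free_shift_inj/basis_vec_inj ->].
by move=> /eqP {1 2}->; rewrite cut_succ eqxx.
Qed.

Lemma succ_graph_clopen : clopen_section succ_graph.
Proof.
have c0 : clopen [set x | ~~ cut d x].
  apply: clopen_negb; have := clopen_cut d 0; congr clopen.
  by apply/funext => x /=; rewrite free_shift0.
split=> // k; have ci := clopen_cut d (basis_vec i).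
suff -> : [set x | adj succ_graph x (free_shift (basis_vec k) x)] =
    [set x | ~~ cut d x && (cut d (free_shift (basis_vec i) x) && (k == j) ||
                            ~~ cut d (free_shift (basis_vec i) x) && (k == i))].
  apply: clopen_andb => //.
  by apply: clopen_orb; apply: clopen_andb; rewrite //;
    [exact: clopen_const|exact: clopen_negb|exact: clopen_const].
apply/funext => x; rewrite /mkset succ_graph_adjE /direction.
by case: (cut d (free_shift (basis_vec i) x)); rewrite /= ?orbF.
Qed.

Lemma succ_graph_complete : complete_section succ_graph.
Proof.
move=> x; exists (succ x); split; first by rewrite /= cut_succ.
by exists (basis_vec (direction x)).
Qed.

Lemma succ_graph_cocomplete : cocomplete_section succ_graph.
Proof.
move=> x; have [g cg] := exists_cut x d_neq0.
by exists (free_shift g x); split; [exists g|rewrite /= cg].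
Qed.

End tree.

End free_part.

Theorem theorem5p2 (n : nat) (hn : (2 <= n)%N) :
  exists T : graph (free_part n),
    [/\ tree_section T, clopen_section T,
        complete_section T & cocomplete_section T].
Proof.
pose i := Ordinal (ltnW hn); pose j := Ordinal hn.
have ij : i <> j by move=> /(congr1 val).
exists (succ_graph i j); split.
- exact: succ_graph_tree_section.
- exact: succ_graph_clopen.
- exact: succ_graph_complete.
- exact: succ_graph_cocomplete.
Qed.
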